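(* For $n\ge1$ let $u(n)$ be the sum of $\mathrm{area}(w)$ over all Catalan words $w$ of length $n$ avoiding the pattern $(\geq,\geq)$. Then \[ \sum_{n\ge1}u(n)x^n=\frac{\left(-2 x^{3}+x^{2}+3 x -1\right) \sqrt{1-2x-3x^{2}}+2 x^{4}+7 x^{3}-4 x +1}{6 x^{6}+4 x^{5}-2 x^{4}}, \] for all $n\ge1$ \[ u(n)=\frac{1}{2}\left(3^{n+1}+2T_{n+1}-T_{n+2}-3T_{n+3}+T_{n+4}\right), \] and $u(n)\sim 3^{n+1}/2$ as $n\to\infty$.
   Context: A Catalan word of length $n\ge 0$ is a sequence $w=w_1\cdots w_n$ of non-negative integers with $w_1=0$ and $0\le w_i\le w_{i-1}+1$ for $i=2,\dots,n$. It avoids the pattern $(\geq,\geq)$ if there is no index $i$ with $w_i\ge w_{i+1}\ge w_{i+2}$. $\mathrm{area}(w)=\sum_{i=1}^n(w_i+1)$. $T_n=\sum_{k=0}^{n}\binom{n}{k}\binom{n-k}{k}$ is the central trinomial coefficient (the coefficient of $x^n$ in $(1+x+x^2)^n$). *)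

(* Defs.v *)
From HB Require Import structures.
From mathcomp Require Import all_boot all_order all_algebra.
From mathcomp Require Import all_classical all_reals all_analysis.

Set Implicit Arguments.
Unset Strict Implicit.
Unset Printing Implicit Defensive.

Import Order.TTheory GRing.Theory Num.Theory.

(* The letter w_i of the text is [nth 0 w i.-1]. *)
Definition catalan_word (w : seq nat) : bool :=
  (nth 0 w 0 == 0) && sorted [rel x y | y <= x.+1] w.

Definition avoids_ge_ge (w : seq nat) : bool :=
  ~~ has (fun i => (nth 0 w i.+1 <= nth 0 w i) && (nth 0 w i.+2 <= nth 0 w i.+1))
         (iota 0 (size w - 2)).

Definition area (w : seq nat) : nat := \sum_(a <- w) a.+1.

(* Words of length n are taken over the finite alphabet {0, ..., n-1}; by this
   lemma no Catalan word of length n is lost. *)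
Lemma catalan_word_ltn (w : seq nat) :
  catalan_word w -> all (fun a => a < size w) w.
Proof.
move=> /andP[/eqP w0 sw]; apply/(all_nthP 0) => i iw.
suff H j : j < size w -> nth 0 w j <= j by exact: leq_ltn_trans (H i iw) iw.
elim: j => [|j IH] jw; first by rewrite w0.
apply: leq_trans (_ : (nth 0 w j).+1 <= _); last by exact: IH (ltnW jw).
by move/(sortedP 0): sw => /(_ j jw).
Qed.

Definition total_area (n : nat) : nat :=
  \sum_(w : n.-tuple 'I_n |
        catalan_word (map val w) && avoids_ge_ge (map val w))
    area (map val w).

Definition central_trinomial (n : nat) : nat :=
  \sum_(0 <= k < n.+1) 'C(n, k) * 'C(n - k, k).

Local Open Scope ring_scope.

(* Formal power series over R, with the Cauchy product. *)
Record fps (R : Type) : Type := Fps { fpscoef : nat -> R }.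

Lemma fpsP (R : Type) (a b : fps R) : fpscoef a =1 fpscoef b -> a = b.
Proof. by case: a b => [a] [b] /= /funext ->. Qed.

HB.instance Definition _ (R : Type) := gen_eqMixin (fps R).
HB.instance Definition _ (R : Type) := gen_choiceMixin (fps R).

Definition fps_zero (R : idomainType) : fps R := Fps (fun=> 0).
Definition fps_opp (R : idomainType) (a : fps R) : fps R :=
  Fps (fun n => - fpscoef a n).
Definition fps_add (R : idomainType) (a b : fps R) : fps R :=
  Fps (fun n => fpscoef a n + fpscoef b n).
Definition fps_one (R : idomainType) : fps R := Fps (fun n => (n == 0%N)%:R).
Definition fps_mul (R : idomainType) (a b : fps R) : fps R :=
  Fps (fun n => \sum_(i < n.+1) fpscoef a i * fpscoef b (n - i)%N).

Lemma fps_addA (R : idomainType) : associative (@fps_add R).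
Proof. by move=> a b c; apply: fpsP => n /=; rewrite addrA. Qed.

Lemma fps_addC (R : idomainType) : commutative (@fps_add R).
Proof. by move=> a b; apply: fpsP => n /=; rewrite addrC. Qed.

Lemma fps_add0 (R : idomainType) : left_id (@fps_zero R) (@fps_add R).
Proof. by move=> a; apply: fpsP => n /=; rewrite add0r. Qed.

Lemma fps_addN (R : idomainType) :
  left_inverse (@fps_zero R) (@fps_opp R) (@fps_add R).
Proof. by move=> a; apply: fpsP => n /=; rewrite addNr. Qed.

HB.instance Definition _ (R : idomainType) :=
  GRing.isZmodule.Build (fps R) (@fps_addA R) (@fps_addC R) (@fps_add0 R)
    (@fps_addN R).

Definition fps_trunc (R : idomainType) (N : nat) (a : fps R) : {poly R} :=
  \poly_(i < N) fpscoef a i.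

Lemma coef_fps_trunc (R : idomainType) (N i : nat) (a : fps R) :
  (i < N)%N -> (fps_trunc N a)`_i = fpscoef a i.
Proof. by move=> iN; rewrite coef_poly iN. Qed.

Lemma coef_fps_mul (R : idomainType) (N n : nat) (a b : fps R) : (n < N)%N ->
  fpscoef (fps_mul a b) n = (fps_trunc N a * fps_trunc N b)`_n.
Proof.
move=> nN; rewrite coefM; apply: eq_bigr => i _.
by rewrite !coef_fps_trunc ?(leq_ltn_trans _ nN) ?leq_subr // -ltnS.
Qed.

Lemma fps_mulA (R : idomainType) : associative (@fps_mul R).
Proof.
move=> a b c; apply: fpsP => n.
pose t := @fps_trunc R n.+1.
transitivity ((t a * (t b * t c))`_n).
  rewrite coefM; apply: eq_bigr => i _.
  by rewrite coef_fps_trunc ?(@coef_fps_mul _ n.+1) // ltnS leq_subr.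
rewrite mulrA coefM; apply: eq_bigr => i _.
by rewrite [in RHS](@coef_fps_mul _ n.+1) // coef_fps_trunc // ltnS leq_subr.
Qed.

Lemma fps_mulC (R : idomainType) : commutative (@fps_mul R).
Proof.
by move=> a b; apply: fpsP => n; rewrite !(@coef_fps_mul _ n.+1) // mulrC.
Qed.

Lemma fps_mul1 (R : idomainType) : left_id (@fps_one R) (@fps_mul R).
Proof.
move=> a; apply: fpsP => n /=.
by rewrite big_ord_recl mul1r subn0 big1 ?addr0 // => i _; rewrite mul0r.
Qed.

Lemma fps_mulDl (R : idomainType) : left_distributive (@fps_mul R) +%R.
Proof.
move=> a b c; apply: fpsP => n /=; rewrite -big_split /=.
by apply: eq_bigr => i _; rewrite mulrDl.
Qed.

Lemma fps_oner_neq0 (R : idomainType) : fps_one R != 0.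
Proof.
by apply/eqP => /(congr1 (fun a => fpscoef a 0)) /eqP; rewrite oner_eq0.
Qed.

HB.instance Definition _ (R : idomainType) :=
  GRing.Zmodule_isComNzRing.Build (fps R) (@fps_mulA R) (@fps_mulC R)
    (@fps_mul1 R) (@fps_mulDl R) (@fps_oner_neq0 R).

Definition fps_unit (R : idomainType) : {pred fps R} :=
  fun a => `[< exists b : fps R, b * a = 1 >].

Definition fps_inv (R : idomainType) (a : fps R) : fps R :=
  xget a [set b : fps R | b * a = 1]%classic.

Lemma fps_mulVx (R : idomainType) :
  {in @fps_unit R, left_inverse 1 (@fps_inv R) *%R}.
Proof.
move=> a /asboolP[b ba].
by apply: (@xgetPex _ a [set b : fps R | b * a = 1]%classic); exists b.
Qed.

Lemma fps_unitPl (R : idomainType) (a b : fps R) : b * a = 1 -> fps_unit a.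
Proof. by move=> ba; apply/asboolP; exists b. Qed.

Lemma fps_invr_out (R : idomainType) :
  {in [predC @fps_unit R], @fps_inv R =1 id}.
Proof.
move=> a /asboolP na; rewrite /fps_inv.
by case: xgetP => // b _ /= ba; case: na; exists b.
Qed.

HB.instance Definition _ (R : idomainType) :=
  GRing.ComNzRing_hasMulInverse.Build (fps R) (@fps_mulVx R) (@fps_unitPl R)
    (@fps_invr_out R).

Lemma fps_order (R : idomainType) (a : fps R) : a != 0 ->
  exists2 n, fpscoef a n != 0 & forall i, (i < n)%N -> fpscoef a i = 0.
Proof.
move=> /eqP a0; have : exists n, fpscoef a n != 0.
  apply: contrapT => na; apply: a0; apply: fpsP => n /=.
  by apply/eqP; apply: contrapT => /negP an; apply: na; exists n.
case/ex_minnP => n an nmin; exists n => // i; rewrite ltnNge => ni.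
by apply/eqP; apply: contraNT ni => /nmin.
Qed.

Lemma fps_mulf_eq0 (R : idomainType) (a b : fps R) :
  a * b = 0 -> (a == 0) || (b == 0).
Proof.
move=> ab0; apply/negPn; rewrite negb_or; apply/negP => /andP[].
move=> /fps_order[m am mmin] /fps_order[n bn nmin].
have /eqP := congr1 (fun c => fpscoef c (m + n)%N) ab0 => /=; apply/negP.
have mn : (m < (m + n).+1)%N by rewrite ltnS leq_addr.
rewrite (bigD1 (Ordinal mn)) //= big1 => [|i].
  by rewrite addr0 addKn mulf_neq0.
rewrite -val_eqE /= => im; have [ltim|leim] := ltnP i m.
  by rewrite mmin // mul0r.
have le_i : (i <= m + n)%N by rewrite -ltnS.
by rewrite nmin ?mulr0 // ltn_subLR // ltn_add2r ltn_neqAle eq_sym im.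
Qed.

HB.instance Definition _ (R : idomainType) :=
  GRing.ComUnitRing_isIntegral.Build (fps R) (@fps_mulf_eq0 R).

Definition fpsX (R : idomainType) : fps R := Fps (fun n => (n == 1%N)%:R).

(* The square root with constant term 1; it exists and is unique whenever a has
   constant term 1, cf. fps_sqrtP and fps_sqrt_unique. *)
Definition fps_sqrt (R : numFieldType) (a : fps R) : fps R :=
  xget 0 [set s : fps R | fpscoef s 0 = 1 /\ s ^+ 2 = a]%classic.

Fixpoint fps_sqrt_seq (R : numFieldType) (a : fps R) (n : nat) : seq R :=
  if n is m.+1 then
    let s := fps_sqrt_seq a m in
    rcons s (if m is 0 then 1 else
             (fpscoef a m - \sum_(1 <= i < m) s`_i * s`_(m - i)) / 2%:R)
  else [::].

Lemma size_fps_sqrt_seq (R : numFieldType) (a : fps R) (n : nat) :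
  size (fps_sqrt_seq a n) = n.
Proof. by elim: n => //= n IH; rewrite size_rcons IH. Qed.

Lemma nth_fps_sqrt_seq (R : numFieldType) (a : fps R) (n i : nat) :
  (i < n)%N -> (fps_sqrt_seq a n)`_i = (fps_sqrt_seq a i.+1)`_i.
Proof.
elim: n => // n IH; rewrite ltnS leq_eqVlt => /predU1P[-> //|lt_in].
by rewrite -IH // [LHS]/= nth_rcons size_fps_sqrt_seq lt_in.
Qed.

Lemma fps_sqrtP (R : numFieldType) (a : fps R) : fpscoef a 0 = 1 ->
  fpscoef (fps_sqrt a) 0 = 1 /\ fps_sqrt a ^+ 2 = a.
Proof.
move=> a0; rewrite /fps_sqrt.
apply: (xgetPex 0 (P := [set s : fps R | fpscoef s 0 = 1 /\ s ^+ 2 = a]%classic)).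
pose s n := (fps_sqrt_seq a n.+1)`_n; exists (Fps s); split=> //=.
apply: fpsP => -[|n]; rewrite expr2 /=; first by rewrite big_ord1 mulr1 a0.
rewrite big_ord_recl big_ord_recr /= subn0 subnn.
have -> : s n.+1 =
    (fpscoef a n.+1 - \sum_(1 <= i < n.+1) s i * s (n.+1 - i)%N) / 2%:R.
  rewrite {1}/s; set t := fps_sqrt_seq a n.+1.
  have -> : fps_sqrt_seq a n.+2 =
    rcons t ((fpscoef a n.+1 - \sum_(1 <= i < n.+1) t`_i * t`_(n.+1 - i)) / 2%:R)
    by [].
  rewrite nth_rcons size_fps_sqrt_seq ltnn eqxx.
  congr (_ / _); congr (_ - _); apply: eq_big_nat => i /andP[i_gt0 i_n].
  rewrite /s /t (nth_fps_sqrt_seq a i_n).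
  by rewrite [in X in _ * X](@nth_fps_sqrt_seq _ a n.+1) // ltn_subrL i_gt0.
have -> : s 0%N = 1 by [].
rewrite mul1r mulr1 addrCA -splitr big_add1 /= big_mkord.
by rewrite addrCA subrr addr0.
Qed.

Lemma fps_sqrt_unique (R : numFieldType) (a s : fps R) :
  fpscoef s 0 = 1 -> s ^+ 2 = a -> s = fps_sqrt a.
Proof.
move=> s0 sa; have a0 : fpscoef a 0 = 1.
  by rewrite -sa expr2 /= big_ord1 s0 mulr1.
have [t0 ta] := fps_sqrtP a0.
have /eqP := etrans sa (esym ta); rewrite eqf_sqr => /predU1P[//|/eqP st].
have /eqP := congr1 (fun c => fpscoef c 0) st; rewrite /= s0 t0.
by rewrite -addr_eq0 -mulr2n pnatr_eq0.
Qed.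

Definition total_area_series (R : numFieldType) : fps R :=
  Fps (fun n => if (0 < n)%N then (total_area n)%:R else 0).

(* Main.v *)
(* Read a word letter by letter, keeping the last letter and whether the last
   step was a weak descent (after one, an ascent is forced).  The generating
   functions f_h and F_h of the number and of the total area of the completions
   from a last letter h - 1 solve linear difference equations in h whose
   characteristic equation (1 + x) L (1 - x L) = 1 has the power series root L
   with sqrt (1 - 2x - 3x^2) = (1 + x)(1 - 2xL).  Hence f_h is affine in L^h,
   and F_h is a quadratic in h times L^h plus an affine term; F_0 is the series
   sought.
   The series c of central trinomial coefficients satisfies
   (1 - 2x - 3x^2) c' = (1 + 3x) c, so c^2 (1 - 2x - 3x^2) has zero derivative
   and c = 1 / sqrt (1 - 2x - 3x^2), which turns F_0 into the explicit formula.
   Finally T_n = o(3^n): with b_n = T_n / 3^n and p_n = b_{n+1} + b_n / 3, the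
   three-term recurrence gives p_{n+1} <= (1 - 1/(3(n+2))) p_n, which forces
   (n + 1) p_n^4 <= 1. *)

Require Import Defs.
From mathcomp Require Import all_boot all_order all_algebra.
From mathcomp Require Import all_classical all_reals all_analysis.
From mathcomp Require Import zify ring lra.

Import Order.TTheory GRing.Theory Num.Theory.
Import numFieldNormedType.Exports.

Local Open Scope classical_set_scope.
Local Open Scope ring_scope.

(** * Enumerating the words letter by letter *)

(* [h] is the last letter plus one, so [h = 0] at the start of a word, and [b]
   records that the last step was a weak descent. *)
Fixpoint completions (n h : nat) (b : bool) : seq (seq nat) :=
  if n is m.+1 then
    map (cons h) (completions m h.+1 false) ++
    (if b then [::]
     else flatten [seq map (cons a) (completions m a.+1 true) | a <- iota 0 h])
  else [:: [::]].

Fixpoint completes (h : nat) (b : bool) (v : seq nat) : bool :=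
  if v is a :: v' then
    if a == h then completes h.+1 false v'
    else [&& (a < h)%N, ~~ b & completes a.+1 true v']
  else true.

Lemma mem_cons_map (T : eqType) (a c : T) (v : seq T) (s : seq (seq T)) :
  (a :: v \in map (cons c) s) = (a == c) && (v \in s).
Proof.
apply/mapP/andP => [[w ws [-> ->]]|[/eqP-> vs]]; first by rewrite eqxx.
by exists v.
Qed.

Lemma mem_completions n h b v :
  (v \in completions n h b) = (size v == n) && completes h b v.
Proof.
elim: n h b v => [|n IH] h b [|a v] //=.
  rewrite mem_cat; apply/negbTE; rewrite negb_or; apply/andP; split.
    by apply/negP => /mapP[].
  by case: b => //; apply/negP => /flatten_mapP[c _ /mapP[]].
rewrite mem_cat mem_cons_map IH eqSS.
case: b => /=.
  rewrite orbF andbF; case: eqP => //= _; by rewrite andbF.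
have -> : (a :: v \in flatten [seq map (cons c) (completions n c.+1 true)
                                  | c <- iota 0 h]) = (a < h)%N && (v \in completions n a.+1 true).
  apply/flatten_mapP/andP => [[c]|[ah va]].
    by rewrite mem_iota mem_cons_map => /= ch /andP[/eqP-> ->].
  by exists a; rewrite ?mem_iota // mem_cons_map eqxx.
rewrite IH; case: eqP => [->|_] /=; first by rewrite ltnn /= orbF.
by rewrite andbCA.
Qed.

Lemma uniq_completions n h b : uniq (completions n h b).
Proof.
have ci (a : nat) : injective (cons a) by move=> u v [].
elim: n h b => // n IH h b /=.
rewrite cat_uniq map_inj_uniq // IH /=; case: b => //=.
apply/andP; split.
  apply/hasPn => w /flatten_mapP[c]; rewrite mem_iota => /= ch /mapP[v _ ->].
  by rewrite mem_cons_map; apply/negP => /andP[/eqP ce]; rewrite ce ltnn in ch.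
elim: (iota 0 h) (iota_uniq 0 h) => //= a s IHs /andP[as_ us].
rewrite cat_uniq map_inj_uniq // IH IHs // andbT /=.
apply/hasPn => w /flatten_mapP[c cs /mapP[v _ ->]].
rewrite mem_cons_map; apply/negP => /andP[/eqP ce _].
by rewrite ce (negbTE as_) in cs.
Qed.

Lemma avoids_cons2 a c v : avoids_ge_ge (a :: c :: v) =
  ~~ ((c <= a)%N && (if v is d :: _ then (d <= c)%N else false)) &&
  avoids_ge_ge (c :: v).
Proof.
rewrite /avoids_ge_ge; case: v => [|d v] /=; first by rewrite andbF.
rewrite !subn2 /= negb_or; congr (_ && ~~ _).
by rewrite (iotaDl 1 0) has_map.
Qed.

(** The flag [b] stands for a weak descent into [a], so it only forbids a second weak descent at the
    first letter of [v]; every later occurrence of the pattern lies inside [a :: v]. *)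
Lemma completes_avoids a b v : completes a.+1 b v =
  [&& path [rel x y | (y <= x.+1)%N] a v, avoids_ge_ge (a :: v) &
      ~~ (b && (if v is c :: _ then (c <= a)%N else false))].
Proof.
elim: v a b => [|c v IH] a b; first by rewrite /= andbF.
rewrite avoids_cons2 /= !IH /= ?andbF ?andbT.
case: (ltngtP c a.+1) => [ca|//|->] /=; last by rewrite ltnn andbF andbT.
rewrite -ltnS ca andbT; case: b => /=; rewrite ?andbF ?andbT //.
by congr (_ && _); rewrite andbC.
Qed.

Lemma completes0 v :
  completes 0 false v = catalan_word v && avoids_ge_ge v.
Proof.
case: v => [|a v] //=; rewrite /catalan_word /=; case: eqP => [->|] //=.
by rewrite completes_avoids /= andbT.
Qed.

(** Both sides sum over duplicate-free lists with the same members. *)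
Lemma total_areaE n : (total_area n = \sum_(v <- completions n 0 false) area v)%N.
Proof.
rewrite /total_area -[LHS]big_filter.
pose tv := fun w : n.-tuple 'I_n => map val w.
rewrite -(big_map tv xpredT area).
apply: perm_big; apply: uniq_perm.
- rewrite map_inj_uniq ?filter_uniq ?index_enum_uniq //.
  by move=> u v /(inj_map val_inj)/val_inj.
- exact: uniq_completions.
move=> v; rewrite mem_completions completes0.
apply/mapP/andP => [[w]|[/eqP sv /andP[cv av]]].
  by rewrite mem_filter => /andP[cw _] ->; rewrite size_map size_tuple.
(* All letters are below [n], so the word lifts to a tuple over ['I_n]. *)
have := catalan_word_ltn cv; rewrite sv => lv.
have st : size (pmap (insub : nat -> option 'I_n) v) == n.
  by rewrite size_pmap_sub -[n in _ == n]sv -all_count.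
have tve : tv (Tuple st) = v.
  rewrite /tv /= (pmap_filter (insubK _)).
  by apply/all_filterP; apply: sub_all lv => a; rewrite isSome_insub.
exists (Tuple st) => //; rewrite mem_filter mem_index_enum andbT.
by rewrite -/(tv _) tve cv av.
Qed.

(** * Coefficient rules for formal power series *)

Lemma fpsXM0 (R : idomainType) (a : fps R) : fpscoef (fpsX R * a) 0 = 0.
Proof. by rewrite /= big_ord1 mul0r. Qed.

Lemma fpsXMS (R : idomainType) (a : fps R) n :
  fpscoef (fpsX R * a) n.+1 = fpscoef a n.
Proof.
rewrite /= big_ord_recl mul0r add0r big_ord_recl mul1r subSS subn0.
by rewrite big1 ?addr0 // => i _; rewrite mul0r.
Qed.

Lemma fpscoefD (R : idomainType) (a b : fps R) n :
  fpscoef (a + b) n = fpscoef a n + fpscoef b n.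
Proof. by []. Qed.

Lemma fpscoefN (R : idomainType) (a : fps R) n :
  fpscoef (- a) n = - fpscoef a n.
Proof. by []. Qed.

Lemma fpscoef0M (R : idomainType) (a b : fps R) :
  fpscoef (a * b) 0 = fpscoef a 0 * fpscoef b 0.
Proof. by rewrite [LHS]/= big_ord1. Qed.

Lemma fpscoef_sum (R : idomainType) I r (P : pred I) (F : I -> fps R) n :
  fpscoef (\sum_(i <- r | P i) F i) n = \sum_(i <- r | P i) fpscoef (F i) n.
Proof. by elim/big_rec2: _ => // i x y _ <-. Qed.

Lemma fpscoef_natM (R : idomainType) m (a : fps R) n :
  fpscoef (m%:R * a) n = m%:R * fpscoef a n.
Proof.
by rewrite !mulr_natl; elim: m => [|m IH]; rewrite ?mulr0n // !mulrS -IH.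
Qed.

Lemma fps_divX (R : idomainType) (a : fps R) :
  fpscoef a 0 = 0 -> exists b, a = fpsX R * b.
Proof.
move=> a0; exists (Fps (fun n => fpscoef a n.+1)); apply: fpsP => -[|n].
  by rewrite fpsXM0.
by rewrite fpsXMS.
Qed.

Lemma fpsX_neq0 (R : idomainType) : fpsX R != 0.
Proof.
by apply/eqP => /(congr1 (fun a => fpscoef a 1)) /eqP; rewrite oner_eq0.
Qed.

Lemma fps_geometric (R : idomainType) (c : R) :
  Fps (fun n => c ^+ n) = 1 + fpsX R * Fps (fun n => c ^+ n.+1).
Proof.
by apply: fpsP => -[|n]; rewrite fpscoefD ?fpsXM0 ?fpsXMS ?addr0 ?add0r.
Qed.

Lemma fps_char0 (R : numFieldType) n : (n.+1%:R : fps R) != 0.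
Proof.
apply/eqP => /(congr1 (fun a => fpscoef a 0)) /eqP.
by rewrite -[n.+1%:R]mulr1 fpscoef_natM mulr1 pnatr_eq0.
Qed.

Lemma fps_halve (R : numFieldType) (a : fps R) : exists b, a = 2%:R * b.
Proof.
exists (Fps (fun n => fpscoef a n / 2%:R)); apply: fpsP => n.
by rewrite fpscoef_natM /= mulrC divfK ?pnatr_eq0.
Qed.

(** * The linear system for the completion series *)

(* By iteration, [H h] is divisible by every power of [x]. *)
Lemma fps_system_unique (R : idomainType) (H : nat -> fps R) :
  (forall h, H h = fpsX R * H h.+1 +
                   fpsX R ^+ 2 * \sum_(0 <= a < h) H a.+2) ->
  forall h, H h = 0.
Proof.
move=> HE h; apply: fpsP => n; rewrite [RHS]/=.
elim/ltn_ind: n h => n IH h; rewrite HE fpscoefD exprS expr1 -mulrA.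
case: n IH => [|n] IH; first by rewrite !fpsXM0 addr0.
rewrite !fpsXMS IH // add0r; case: n IH => [|n] IH; first by rewrite fpsXM0.
by rewrite fpsXMS fpscoef_sum big1 // => i _; rewrite IH.
Qed.

Definition count_series (R : idomainType) h b : fps R :=
  Fps (fun n => (size (completions n h b))%:R).

Definition area_series (R : idomainType) h b : fps R :=
  Fps (fun n => (\sum_(v <- completions n h b) area v)%N%:R).

Lemma area_cons a v : area (a :: v) = (a.+1 + area v)%N.
Proof. by rewrite /area big_cons. Qed.

Lemma sum_area_cons a s :
  (\sum_(v <- map (cons a) s) area v = a.+1 * size s + \sum_(v <- s) area v)%N.
Proof.
rewrite big_map; under eq_bigr do rewrite area_cons.
rewrite big_split /=.
by rewrite big_const_seq count_predT iter_addn_0.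
Qed.

Lemma count_series_true (R : idomainType) h :
  count_series R h true = 1 + fpsX R * count_series R h.+1 false.
Proof.
apply: fpsP => -[|n]; rewrite fpscoefD ?fpsXM0 ?fpsXMS ?addr0 ?add0r //=.
by rewrite cats0 size_map.
Qed.

Lemma count_series_false (R : idomainType) h :
  count_series R h false = 1 + fpsX R * count_series R h.+1 false
    + fpsX R * \sum_(0 <= a < h) count_series R a.+1 true.
Proof.
apply: fpsP => -[|n]; rewrite !fpscoefD ?fpsXM0 ?fpsXMS ?addr0 ?add0r //=.
rewrite size_cat size_map natrD fpscoef_sum /= size_flatten.
rewrite /shape -map_comp sumnE big_map natr_sum /index_iota subn0.
by congr (_ + _); apply: eq_bigr => a _ /=; rewrite size_map.
Qed.

(** Prepending the letter [h] adds [h + 1] to the area of each completion, whence the count term;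
    the empty word has area 0, so no constant term appears. *)
Lemma area_series_true (R : idomainType) h :
  area_series R h true =
  fpsX R * (area_series R h.+1 false + h.+1%:R * count_series R h.+1 false).
Proof.
apply: fpsP => -[|n].
  by rewrite fpsXM0 /= big_seq1 /area big_nil.
rewrite fpsXMS fpscoefD fpscoef_natM /= cats0 sum_area_cons.
by rewrite natrD natrM addrC.
Qed.

Lemma area_series_false (R : idomainType) h :
  area_series R h false =
  fpsX R * (area_series R h.+1 false + h.+1%:R * count_series R h.+1 false) +
  fpsX R * \sum_(0 <= a < h)
     (area_series R a.+1 true + a.+1%:R * count_series R a.+1 true).
Proof.
apply: fpsP => -[|n].
  by rewrite fpscoefD !fpsXM0 /= big_seq1 /area big_nil addr0.
rewrite fpscoefD !fpsXMS fpscoefD fpscoef_natM /= fpscoef_sum.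
rewrite big_cat sum_area_cons big_flatten big_map natrD; congr (_ + _).
  by rewrite natrD natrM addrC.
rewrite natr_sum /index_iota subn0; apply: eq_bigr => a _.
by rewrite fpscoefD fpscoef_natM sum_area_cons natrD natrM addrC.
Qed.

Lemma total_area_seriesE (R : numFieldType) :
  total_area_series R = area_series R 0 false.
Proof.
apply: fpsP => -[|n] /=; last by rewrite total_areaE.
by rewrite big_seq1 /area big_nil.
Qed.

(** * Closed forms modulo the algebraic relation for [L] *)

(* Makes [x] and [L] rational in [t = x L], so that identities modulo the
   relation become identities of rational functions. *)
Lemma catalan_parametrization (K : fieldType) (x L : K) :
  (1 + x) * L * (1 - x * L) = 1 ->
  exists t, [/\ 1 - t != 0, 1 - t + t ^+ 2 != 0,
    x = t * (1 - t) / (1 - t + t ^+ 2) & L = (1 - t + t ^+ 2) / (1 - t)].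
Proof.
move=> rel; exists (x * L).
have Lt0 : 1 - x * L != 0.
  by apply/eqP => z; move: rel; rewrite z mulr0 => /esym/eqP; rewrite oner_eq0.
have L0 : L != 0.
  by apply/eqP => z; move: rel; rewrite z mulr0 mul0r => /esym/eqP; rewrite oner_eq0.
have DE : 1 - x * L + (x * L) ^+ 2 = L * (1 - x * L).
  by rewrite -{1}rel; ring.
have D0 : 1 - x * L + (x * L) ^+ 2 != 0 by rewrite DE mulf_neq0.
split=> //; first by rewrite DE; field; rewrite Lt0.
by rewrite DE mulfK.
Qed.

(* [count_closed] at [P = L ^+ h] is [x f_h]; [area_closed] at [y = h] and
   [P = L ^+ h] is [2 x^3 (1 - 2 x L)^2 F_h], the factor clearing denominators,
   and [(1 + x) * L] stands for [1 / (1 - x L)]. *)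
Definition count_closed (A : comNzRingType) (x L P : A) : A :=
  (1 + x) * (P * L) - 1.

Definition area_quad (A : comNzRingType) (x L : A) : A :=
  let t := x * L in x ^+ 3 * L * (t * (2%:R - t) * (1 - 2%:R * t)) * ((1 + x) * L).

Definition area_lin (A : comNzRingType) (x L : A) : A :=
  let t := x * L in
  (x ^+ 3 * L * (t * (2%:R - t)) + 2%:R * x ^+ 3 * (1 - 2%:R * t) * L) * ((1 + x) * L).

Definition area_const (A : comNzRingType) (x L : A) : A :=
  let t := x * L in
  ((1 + x) * L) * (t * (area_quad A x L + area_lin A x L)
    - 2%:R * (1 - x) * (1 - 2%:R * t) ^+ 2
    + (1 + x) * L ^+ 2 * (2%:R * x ^+ 3 * (1 - 2%:R * t) ^+ 2)).

Definition area_closed (A : comNzRingType) (x L y P : A) : A :=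
  (area_quad A x L * y ^+ 2 + area_lin A x L * y + area_const A x L) * P
  + 2%:R * (1 - 2%:R * (x * L)) ^+ 2 * (x ^+ 2 * y + 1).

Section FieldIdentities.
Variables (K : fieldType) (x L : K).
Hypothesis rel : (1 + x) * L * (1 - x * L) = 1.

(** With [P = L ^+ h], this is the equation for [x f_h] differenced in [h], which removes the sum
    over smaller letters. The area equation is treated likewise below. *)
Lemma count_closed_step_field P :
  count_closed K x L (P * L) - count_closed K x L P =
  x * (count_closed K x L (P * L * L) - count_closed K x L (P * L))
  + x ^+ 2 * (1 + count_closed K x L (P * L * L)).
Proof.
have [t [t1 D0 -> ->]] := catalan_parametrization K x L rel.
by rewrite /count_closed; field; rewrite t1 D0.
Qed.

Lemma area_closed0_field :
  area_closed K x L 0 1 = x * (area_closed K x L 1 L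
     + 2%:R * x ^+ 2 * (1 - 2%:R * (x * L)) ^+ 2 * count_closed K x L L).
Proof.
have [t [t1 D0 -> ->]] := catalan_parametrization K x L rel.
rewrite /area_closed /area_const /area_lin /area_quad /count_closed.
by field; rewrite t1 D0.
Qed.

Lemma area_closed_step_field y P :
  let N := 2%:R * x ^+ 2 * (1 - 2%:R * (x * L)) ^+ 2 in
  area_closed K x L (y + 1) (P * L) - area_closed K x L y P =
  x * (area_closed K x L (y + 2%:R) (P * L * L)
       + (y + 2%:R) * (N * count_closed K x L (P * L * L)))
  - x * (area_closed K x L (y + 1) (P * L) + (y + 1) * (N * count_closed K x L (P * L)))
  + x * (x * (area_closed K x L (y + 2%:R) (P * L * L)
         + (y + 2%:R) * (N * count_closed K x L (P * L * L)))
         + (y + 1) * (x * N * (1 + count_closed K x L (P * L * L)))).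
Proof.
have [t [t1 D0 -> ->]] := catalan_parametrization K x L rel.
rewrite /area_closed /area_const /area_lin /area_quad /count_closed /=.
by field; rewrite t1 D0.
Qed.

Lemma area_closed_total_field :
  let s := (1 + x) * (1 - 2%:R * (x * L)) in
  x * (1 + x) ^+ 2 * area_closed K x L 0 1 =
  - ((- 2%:R * x ^+ 3 + x ^+ 2 + 3%:R * x - 1) * s
     + 2%:R * x ^+ 4 + 7%:R * x ^+ 3 - 4%:R * x + 1).
Proof.
have [t [t1 D0 -> ->]] := catalan_parametrization K x L rel.
rewrite /area_closed /area_const /area_lin /area_quad /=.
by field; rewrite t1 D0.
Qed.

End FieldIdentities.

Section ClosedForms.
Variables (A : idomainType) (x L : A).
Hypothesis rel : (1 + x) * L * (1 - x * L) = 1.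

Let tofrac_inj : injective (@tofrac A).
Proof. by move=> a b /eqP; rewrite tofrac_eq => /eqP. Qed.

Let rel_frac : (1 + tofrac x) * tofrac L * (1 - tofrac x * tofrac L) = 1.
Proof. by rewrite -tofrac1 -!(tofracM, tofracB, tofracD) rel. Qed.

(** A domain embeds in its fraction field, where the field version applies; [ring] only pushes
    [tofrac] through the polynomial expressions. The next three lemmas are transferred in the same
    way. *)
Lemma count_closed_step P :
  count_closed A x L (P * L) - count_closed A x L P =
  x * (count_closed A x L (P * L * L) - count_closed A x L (P * L))
  + x ^+ 2 * (1 + count_closed A x L (P * L * L)).
Proof.
apply: tofrac_inj; have E := count_closed_step_field _ _ _ rel_frac (tofrac P).
by apply: etrans (etrans _ E) _;
  rewrite /area_closed /area_const /area_lin /area_quad /count_closed /=; ring.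
Qed.

Lemma area_closed0 :
  area_closed A x L 0 1 = x * (area_closed A x L 1 L
     + 2%:R * x ^+ 2 * (1 - 2%:R * (x * L)) ^+ 2 * count_closed A x L L).
Proof.
apply: tofrac_inj; have E := area_closed0_field _ _ _ rel_frac.
by apply: etrans (etrans _ E) _;
  rewrite /area_closed /area_const /area_lin /area_quad /count_closed /=; ring.
Qed.

Lemma area_closed_step y P :
  let N := 2%:R * x ^+ 2 * (1 - 2%:R * (x * L)) ^+ 2 in
  area_closed A x L (y + 1) (P * L) - area_closed A x L y P =
  x * (area_closed A x L (y + 2%:R) (P * L * L)
       + (y + 2%:R) * (N * count_closed A x L (P * L * L)))
  - x * (area_closed A x L (y + 1) (P * L) + (y + 1) * (N * count_closed A x L (P * L)))
  + x * (x * (area_closed A x L (y + 2%:R) (P * L * L)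
         + (y + 2%:R) * (N * count_closed A x L (P * L * L)))
         + (y + 1) * (x * N * (1 + count_closed A x L (P * L * L)))).
Proof.
apply: tofrac_inj.
have E := area_closed_step_field _ _ _ rel_frac (tofrac y) (tofrac P).
by apply: etrans (etrans _ E) _;
  rewrite /area_closed /area_const /area_lin /area_quad /count_closed /=; ring.
Qed.

Lemma area_closed_total :
  let s := (1 + x) * (1 - 2%:R * (x * L)) in
  x * (1 + x) ^+ 2 * area_closed A x L 0 1 =
  - ((- 2%:R * x ^+ 3 + x ^+ 2 + 3%:R * x - 1) * s
     + 2%:R * x ^+ 4 + 7%:R * x ^+ 3 - 4%:R * x + 1).
Proof.
apply: tofrac_inj; have E := area_closed_total_field _ _ _ rel_frac.
by apply: etrans (etrans _ E) _;
  rewrite /area_closed /area_const /area_lin /area_quad /count_closed /=; ring.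
Qed.

End ClosedForms.

(** * The generating function of the total area *)

Definition discriminant (R : idomainType) : fps R :=
  1 - 2%:R * fpsX R - 3%:R * fpsX R ^+ 2.

Lemma discriminant0 (R : idomainType) : fpscoef (discriminant R) 0 = 1.
Proof.
rewrite /discriminant !(fpscoefD, fpscoefN, fpscoef_natM) expr2 fpsXM0.
by rewrite /= !mulr0 !subr0.
Qed.

Lemma sqrt_discriminant (R : numFieldType) :
  let x := fpsX R in
  exists L : fps R, (1 + x) * L * (1 - x * L) = 1 /\
    fps_sqrt (discriminant R) = (1 + x) * (1 - 2%:R * (x * L)).
Proof.
move=> x; have [s0 sE] := fps_sqrtP (discriminant0 R).
set s := fps_sqrt _ in s0 sE *.
(* [L] is [(1 + x - s) / (2 x (1 + x))]: the numerator has constant term 0, and [1 + x] is inverted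
   by the alternating series. *)
have [e eE] : exists e, e * (1 + x) = 1.
  exists (Fps (fun n => (-1) ^+ n)).
  rewrite mulrDr mulr1 [_ * x]mulrC {1}fps_geometric -addrA -mulrDr.
  rewrite [X in x * X](_ : _ = 0) ?mulr0 ?addr0 //.
  by apply: fpsP => n /=; rewrite exprS mulN1r addNr.
have [b bE] : exists b, 1 + x - s = x * b.
  by apply: fps_divX; rewrite !(fpscoefD, fpscoefN) s0 /= addr0 subrr.
have [L LE] := fps_halve R (b * e).
have sL : s = (1 + x) * (1 - 2%:R * (x * L)).
  transitivity (1 + x - x * b * (e * (1 + x))).
    by rewrite eE mulr1 -bE opprB addrC subrK.
  transitivity ((1 + x) * (1 - x * (b * e))); first by ring.
  by rewrite LE; ring.
have x1 : 1 + x != 0.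
  by apply/eqP => z; move/eqP: eE; rewrite z mulr0 eq_sym oner_eq0.
exists L; split => //.
(* The discriminant minus [s ^+ 2] is this factor times the defect of the relation for [L]. *)
have c0 : 4%:R * x * (1 + x) != 0 by rewrite !mulf_neq0 ?fps_char0 ?fpsX_neq0.
apply: (mulfI c0); apply/eqP; rewrite -subr_eq0.
rewrite (_ : _ - _ = discriminant R - s ^+ 2); first by rewrite sE subrr.
by rewrite sL /discriminant -/x; ring.
Qed.

(** Puts back the sum that differencing removed, so that the closed forms satisfy the same system as
    the series. *)
Lemma telescope_eq (V : zmodType) (C u v : nat -> V) :
  C 0%N = u 0%N -> (forall k, C k.+1 - C k = u k.+1 - u k + v k) ->
  forall k, C k = u k + \sum_(0 <= a < k) v a.
Proof.
move=> C0 CS; elim=> [|k IH]; first by rewrite big_geq // addr0.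
have /eqP := CS k; rewrite subr_eq => /eqP ->.
by rewrite big_nat_recr //= IH addrACA subrK [v k + _]addrC.
Qed.

Section Series.
Variables (R : numFieldType) (L : fps R).
Let x := fpsX R.
Hypothesis rel : (1 + x) * L * (1 - x * L) = 1.

(** Both sides solve the same inhomogeneous system ([CE] and [FE]); their difference solves the
    homogeneous one and vanishes by [fps_system_unique]. *)
Lemma count_series_closed h :
  x * count_series R h false = count_closed (fps R) x L (L ^+ h).
Proof.
pose C k : fps R := count_closed (fps R) x L (L ^+ k).
have CE k : C k = x + x * C k.+1 + x ^+ 2 * \sum_(0 <= a < k) (1 + C a.+2).
  rewrite mulr_sumr; apply: (telescope_eq _ C (fun k => x + x * C k.+1)) => [|{}k].
    rewrite /C /count_closed expr0 expr1.
    have -> : (1 + x) * (1 * L) = 1 + (1 + x) * (x * L ^+ 2).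
      by rewrite -[X in _ = X + _]rel; ring.
    by ring.
  rewrite [X in _ = X + _](_ : _ = x * (C k.+2 - C k.+1)); last by ring.
  by have := count_closed_step _ _ _ rel (L ^+ k); rewrite -!exprSr.
have FE k : x * count_series R k false =
    x + x * (x * count_series R k.+1 false)
    + x ^+ 2 * \sum_(0 <= a < k) (1 + x * count_series R a.+2 false).
  rewrite {1}count_series_false -/x.
  under eq_bigr do rewrite count_series_true -/x.
  by ring.
apply/eqP; rewrite -subr_eq0; apply/eqP; move: h.
apply: fps_system_unique => h; rewrite -/x -!/(C _) {1}CE {1}FE.
rewrite [X in _ = _ + _ ^+ 2 * X](_ : _ =
  \sum_(0 <= a < h) (1 + x * count_series R a.+2 false) -
  \sum_(0 <= a < h) (1 + C a.+2)).
  by ring.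
by rewrite -sumrB; apply: eq_bigr => a _; rewrite -/(C _); ring.
Qed.

Let N := 2%:R * x ^+ 2 * (1 - 2%:R * (x * L)) ^+ 2.

Lemma area_series_closed h :
  x * N * area_series R h false = area_closed (fps R) x L h%:R (L ^+ h).
Proof.
pose K k : fps R := area_closed (fps R) x L k%:R (L ^+ k).
pose c k : fps R := count_closed (fps R) x L (L ^+ k).
have CE k : K k = x * (K k.+1 + k.+1%:R * (N * c k.+1))
    + x * \sum_(0 <= a < k)
        (x * (K a.+2 + a.+2%:R * (N * c a.+2)) + a.+1%:R * (x * N * (1 + c a.+2))).
  rewrite mulr_sumr.
  apply: (telescope_eq _ K (fun k => x * (K k.+1 + k.+1%:R * (N * c k.+1)))) => [|{}k].
    by rewrite /K /c !expr1 expr0 mul1r; exact: (area_closed0 _ _ _ rel).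
  have := area_closed_step _ _ _ rel k%:R (L ^+ k).
  by rewrite -!exprSr !natr1 -!natrD addn2.
have FE k : x * N * area_series R k false =
    x * (x * N * area_series R k.+1 false + k.+1%:R * (N * c k.+1))
    + x * \sum_(0 <= a < k)
        (x * (x * N * area_series R a.+2 false + a.+2%:R * (N * c a.+2))
         + a.+1%:R * (x * N * (1 + c a.+2))).
  rewrite {1}area_series_false -/x mulrDr; congr (_ + _).
    by rewrite /c -count_series_closed; ring.
  rewrite mulrCA; congr (_ * _); rewrite mulr_sumr; apply: eq_bigr => a _.
  rewrite area_series_true count_series_true -/x /c -count_series_closed; ring.
apply/eqP; rewrite -subr_eq0; apply/eqP; move: h.
apply: fps_system_unique => h; rewrite -/x -!/(K _) {1}CE {1}FE.
rewrite [X in _ = _ + _ ^+ 2 * X](_ : _ =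
  \sum_(0 <= a < h) (x * N * area_series R a.+2 false - K a.+2)) //.
set S1 := \sum_(0 <= a < h) _; set S2 := \sum_(0 <= a < h) _.
(* The count terms are common to both systems and cancel. *)
have -> : S1 = S2 + x * \sum_(0 <= a < h) (x * N * area_series R a.+2 false - K a.+2).
  rewrite mulr_sumr -big_split; apply: eq_bigr => a _ /=; ring.
by ring.
Qed.

End Series.

(** The denominator is [- 2 x^4 s^2] with [s] the square root, and [2 x^4 s^2] is the product of the
    factors [x (1 + x)^2] and [2 x^3 (1 - 2 x L)^2] introduced by the closed form. *)
Lemma total_area_series_eq (R : numFieldType) :
  let x := fpsX R in
  total_area_series R * (6%:R * x ^+ 6 + 4%:R * x ^+ 5 - 2%:R * x ^+ 4) =
  (- 2%:R * x ^+ 3 + x ^+ 2 + 3%:R * x - 1) * fps_sqrt (discriminant R)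
  + 2%:R * x ^+ 4 + 7%:R * x ^+ 3 - 4%:R * x + 1.
Proof.
move=> x; have [L [rel sE]] := sqrt_discriminant R.
have := area_closed_total _ _ _ rel; rewrite /= -/x -sE.
have := area_series_closed R L rel 0; rewrite -total_area_seriesE expr0 -/x.
move=> <- E; apply: oppr_inj; rewrite -E {E}.
have [_ s2] := fps_sqrtP (discriminant0 R).
have -> : 6%:R * x ^+ 6 + 4%:R * x ^+ 5 - 2%:R * x ^+ 4 =
  - 2%:R * x ^+ 4 * fps_sqrt (discriminant R) ^+ 2.
  by rewrite s2 /discriminant -/x; ring.
by rewrite sE -/x; ring.
Qed.

(** * The three-term recurrence of the central trinomial coefficients *)

(** For [2k <= n] both products are [n! / (k!^2 (n - 2k)!)], otherwise both vanish. On the right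
    only one factor depends on [n]. *)
Lemma bin_bin_sub n k :
  ('C(n, k) * 'C(n - k, k) = 'C(n, k.*2) * 'C(k.*2, k))%N.
Proof.
have [n2k|n2k] := ltnP n k.*2.
  by rewrite [in RHS]bin_small // (@bin_small (n - k)%N) ?muln0 //; lia.
have h : (0 < k`! * k`! * (n - k.*2)`!)%N by rewrite !muln_gt0 !fact_gt0.
apply/eqP; rewrite -(eqn_pmul2r h); apply/eqP.
have e1 : ('C(n, k) * (k`! * (n - k)`!))%N = n`! by apply: bin_fact; lia.
have e2 : ('C(n - k, k) * (k`! * (n - k.*2)`!))%N = (n - k)`!.
  by rewrite -(_ : n - k - k = n - k.*2)%N; [apply: bin_fact|]; lia.
have e3 : ('C(n, k.*2) * (k.*2`! * (n - k.*2)`!))%N = n`! by apply: bin_fact.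
have e4 : ('C(k.*2, k) * (k`! * k`!))%N = k.*2`!.
  by rewrite -[X in (_ * (_ * X`!))%N](_ : k.*2 - k = k)%N; [apply: bin_fact|]; lia.
transitivity n`!; first by rewrite -e1 -e2; ring.
by rewrite -e3 -e4; ring.
Qed.

Lemma central_bin_rec k :
  (k.+1 * 'C(k.+1.*2, k.+1) = 2 * k.*2.+1 * 'C(k.*2, k))%N.
Proof.
have := mul_bin_diag k.+1.*2 k; have := mul_bin_down k.*2.+1 k.
rewrite doubleS /= (_ : k.*2.+1 - k = k.+1)%N; last by lia.
move=> e1 e2; apply/eqP; rewrite -(@eqn_pmul2l k.+1) //; apply/eqP.
rewrite -e2; transitivity (2 * k.+1 * (k.+1 * 'C(k.*2.+1, k)))%N; first lia.
rewrite -e1; ring.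
Qed.

(* Zeilberger's certificate for [t] is [- 4 (n + 1) t n (k - 1)]; here it is moved
   across so that no subtraction occurs. *)
Lemma trinomial_term_rec n k (t := fun n k => ('C(n, k.*2) * 'C(k.*2, k))%N) :
  (n.+2 * t n.+2 k.+1 + n.+1 * t n k.+1 =
   (2 * n + 3) * t n.+1 k.+1 + 4 * n.+1 * t n k)%N.
Proof.
rewrite /t; have e := central_bin_rec k; have := mul_bin_left n k.*2.
rewrite doubleS in e *; move: e; set d := 'C(k.*2.+2, k.+1).
(* After Pascal's rule the terms in [a] cancel, and the claim reduces to [E2]. *)
rewrite !binS.
set a := 'C(n, k.*2.+2); set b := 'C(n, k.*2.+1); set c := 'C(n, k.*2).
set f := 'C(k.*2, k).
move=> e e'.
have E : (k.*2.+1 * (b + n.+2 * c) = 2 * k.+1 * n.+1 * c)%N.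
  (* For [n < 2k] the subtraction in [e'] truncates, but then [c] is 0. *)
  rewrite mulnDr e'; have [nk|nk] := leqP k.*2 n; last first.
    by rewrite /c bin_small // !muln0.
  rewrite mulnA -mulnDl; congr (_ * _)%N; nia.
have E2 : ((b + n.+2 * c) * d = 4 * n.+1 * (c * f))%N.
  apply/eqP; rewrite -(@eqn_pmul2l (k.*2.+1 * k.+1)) //; apply/eqP.
  transitivity ((k.*2.+1 * (b + n.+2 * c)) * (k.+1 * d))%N; first by ring.
  by rewrite E e; ring.
rewrite -E2; ring.
Qed.

(** A free upper bound lets the sums for [n], [n + 1] and [n + 2] share one range. *)
Lemma central_trinomialE N n : (n < N)%N ->
  (central_trinomial n = \sum_(0 <= k < N) 'C(n, k.*2) * 'C(k.*2, k))%N.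
Proof.
move=> nN; rewrite /central_trinomial (@big_cat_nat _ _ _ n.+1 0 N) //=.
rewrite [X in (_ + X)%N]big_nat_cond [X in (_ + X)%N]big1 ?addn0.
  by apply: eq_bigr => k _; rewrite bin_bin_sub.
by move=> k /andP[/andP[nk _] _]; rewrite bin_small //; lia.
Qed.

Lemma central_trinomial0 : central_trinomial 0 = 1%N.
Proof. by rewrite /central_trinomial big_nat1. Qed.

Lemma central_trinomial1 : central_trinomial 1 = 1%N.
Proof. by rewrite /central_trinomial !big_nat_recl // big_geq. Qed.

Lemma central_trinomial_rec n :
  (n.+2 * central_trinomial n.+2 =
   (2 * n + 3) * central_trinomial n.+1 + 3 * n.+1 * central_trinomial n)%N.
Proof.
have e0 := central_trinomialE n.+2 n (leqnSn _).
rewrite (central_trinomialE n.+3) // (central_trinomialE n.+3 n.+1) //.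
have := central_trinomialE n.+3 n (leqW (leqnSn _)).
(* The split-off terms at [k = 0] are all 1 and balance, as [(n + 2) + (n + 1) = 2n + 3]. *)
rewrite ![(\sum_(0 <= k < n.+3) _)%N]big_nat_recl // !bin0 => e1.
pose t m k := ('C(m, k.*2) * 'C(k.*2, k))%N.
have : (n.+2 * \sum_(0 <= k < n.+2) t n.+2 k.+1
        + n.+1 * \sum_(0 <= k < n.+2) t n k.+1 =
        (2 * n + 3) * \sum_(0 <= k < n.+2) t n.+1 k.+1
        + 4 * n.+1 * \sum_(0 <= k < n.+2) t n k)%N.
  rewrite !big_distrr -!big_split; apply: eq_bigr => k _.
  exact: trinomial_term_rec.
rewrite -[X in (_ = _ + _ * X)%N]e0 e1.
rewrite -!/(t _ _.+1).
set A := (\sum_(0 <= k < n.+2) t n.+2 _)%N; set B := (\sum_(0 <= k < n.+2) t n _)%N.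
set C := (\sum_(0 <= k < n.+2) t n.+1 _)%N; lia.
Qed.

(** * Derivation and the generating function of the central trinomial coefficients *)

Definition fps_deriv (R : idomainType) (a : fps R) : fps R :=
  Fps (fun n => n.+1%:R * fpscoef a n.+1).

Section Derivation.
Variable R : idomainType.
Implicit Types a b : fps R.

Lemma fps_derivD a b : fps_deriv R (a + b) = fps_deriv R a + fps_deriv R b.
Proof. by apply: fpsP => n; rewrite /= mulrDr. Qed.

Lemma fps_derivN a : fps_deriv R (- a) = - fps_deriv R a.
Proof. by apply: fpsP => n; rewrite /= mulrN. Qed.

Lemma fps_deriv_natM m a : fps_deriv R (m%:R * a) = m%:R * fps_deriv R a.
Proof. apply: fpsP => n; rewrite [RHS]fpscoef_natM.
by rewrite -[LHS]/(n.+1%:R * fpscoef (m%:R * a) n.+1) fpscoef_natM mulrCA. Qed.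

Lemma fps_deriv1 : fps_deriv R 1 = 0.
Proof. by apply: fpsP => n; rewrite /= mulr0. Qed.

Lemma fps_derivX : fps_deriv R (fpsX R) = 1.
Proof. by apply: fpsP => -[|n]; rewrite /= ?mulr0 ?mulr1. Qed.

(** Reduces to the product rule for polynomials, truncating at degree below [n + 2] because
    coefficient [n] of a derivative involves coefficient [n + 1]. *)
Lemma fps_derivM a b :
  fps_deriv R (a * b) = fps_deriv R a * b + a * fps_deriv R b.
Proof.
apply: fpsP => n; rewrite fpscoefD -[LHS]/(n.+1%:R * fpscoef (a * b) n.+1).
have cE c k : (k <= n)%N ->
    (deriv (fps_trunc n.+2 c))`_k = fpscoef (fps_deriv R c) k.
  by move=> kn; rewrite coef_deriv coef_fps_trunc // -mulr_natl.
rewrite (@coef_fps_mul _ n.+2) // mulr_natl -coef_deriv derivM coefD !coefM.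
congr (_ + _); apply: eq_bigr => -[k kn] _ /=.
  by rewrite cE // coef_fps_trunc //; lia.
by rewrite cE ?leq_subr // coef_fps_trunc //; lia.
Qed.

End Derivation.

Definition trinomial_series (R : idomainType) : fps R :=
  Fps (fun n => (central_trinomial n)%:R).

(** Coefficientwise this is the three-term recurrence; degree 0 uses the initial values alone. *)
Lemma trinomial_series_ode (R : idomainType) :
  discriminant R * fps_deriv R (trinomial_series R) =
  (1 + 3%:R * fpsX R) * trinomial_series R.
Proof.
set c := trinomial_series R; set x := fpsX R.
have -> : discriminant R * fps_deriv R c =
  fps_deriv R c - 2%:R * (x * fps_deriv R c) - 3%:R * (x * (x * fps_deriv R c)).
  by rewrite /discriminant -/x; ring.
have -> : (1 + 3%:R * x) * c = c + 3%:R * (x * c) by ring.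
have rec n : n.+2%:R * fpscoef c n.+2 = (2 * n + 3)%:R * fpscoef c n.+1
    + (3 * n.+1)%:R * fpscoef c n.
  by rewrite /= -!natrM central_trinomial_rec natrD.
have dE n : fpscoef (fps_deriv R c) n = n.+1%:R * fpscoef c n.+1 by [].
have c0 : fpscoef c 0 = 1 by rewrite /= central_trinomial0.
have c1 : fpscoef c 1 = 1 by rewrite /= central_trinomial1.
apply: fpsP => -[|[|n]];
  rewrite !(fpscoefD, fpscoefN, fpscoef_natM) ?fpsXM0 ?fpsXMS ?fpsXM0 !dE.
- by rewrite c0 c1; ring.
- by rewrite rec c0 c1; ring.
by rewrite rec; ring.
Qed.

Lemma trinomial_series_sqrt (R : numFieldType) :
  trinomial_series R * discriminant R = fps_sqrt (discriminant R).
Proof.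
set c := trinomial_series R; set d := discriminant R.
have c0 : fpscoef c 0 = 1 by rewrite /= central_trinomial0.
have d' : fps_deriv R d = - (2%:R * (1 + 3%:R * fpsX R)).
  rewrite /d /discriminant expr2.
  rewrite !(fps_derivD, fps_derivN, fps_deriv_natM, fps_derivM, fps_deriv1, fps_derivX).
  by ring.
have z : fps_deriv R (c * c * d) = 0.
  rewrite !fps_derivM d'.
  transitivity (2%:R * c * (d * fps_deriv R c - (1 + 3%:R * fpsX R) * c)).
    by ring.
  by rewrite trinomial_series_ode subrr mulr0.
have ccd : c * c * d = 1.
  apply: fpsP => -[|n].
    by rewrite !fpscoef0M c0 (discriminant0 R) !mulr1.
  have /eqP := congr1 (fun a => fpscoef a n) z.
  by rewrite mulf_eq0 pnatr_eq0 => /eqP.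
(* From [c^2 d = 1] follows [(c d)^2 = d]. *)
apply: fps_sqrt_unique; first by rewrite fpscoef0M c0 (discriminant0 R) mulr1.
by transitivity (c * c * d * d); [ring|rewrite ccd mul1r].
Qed.

(** * The explicit formula *)

(** The discriminant is [(1 + x) (1 - 3x)]. Dividing by it turns the square root into the trinomial
    series and the rational part into a polynomial plus a geometric series of ratio 3. *)
Lemma total_area_series_trinomial (R : numFieldType) :
  let x := fpsX R in
  2%:R * x ^+ 4 * total_area_series R =
  3%:R * x ^+ 4 * Fps (fun n => 3%:R ^+ n)
  + (2%:R * x ^+ 3 - x ^+ 2 - 3%:R * x + 1) * trinomial_series R
  + (- 1 + 2%:R * x + x ^+ 2 + x ^+ 3).
Proof.
move=> x; set e := Fps _; set c := trinomial_series R.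
have eE : e * (1 - 3%:R * x) = 1.
  have h : e = 1 + x * (3%:R * e).
    rewrite {1}/e fps_geometric; congr (_ + _ * _).
    by apply: fpsP => n; rewrite fpscoef_natM /= exprS.
  transitivity (e - x * (3%:R * e)); first by ring.
  by rewrite {1}h addrK.
have d0 : discriminant R != 0.
  apply/eqP => /(congr1 (fun a => fpscoef a 0)) /eqP.
  by rewrite discriminant0 oner_eq0.
have := total_area_series_eq R; rewrite /= -/x -trinomial_series_sqrt -/c => E.
suff : 2%:R * x ^+ 4 * total_area_series R * discriminant R =
  (3%:R * x ^+ 4 * e
  + (2%:R * x ^+ 3 - x ^+ 2 - 3%:R * x + 1) * c
  + (- 1 + 2%:R * x + x ^+ 2 + x ^+ 3)) * discriminant R by exact: mulIf.
have e3 : 3%:R * x ^+ 4 * e * discriminant R = 3%:R * x ^+ 4 * (1 + x).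
  transitivity (3%:R * x ^+ 4 * (1 + x) * (e * (1 - 3%:R * x))).
    by rewrite /discriminant -/x; ring.
  by rewrite eE mulr1.
rewrite -addrA [RHS]mulrDl e3.
transitivity (- (total_area_series R *
  (6%:R * x ^+ 6 + 4%:R * x ^+ 5 - 2%:R * x ^+ 4))).
  by rewrite /discriminant -/x; ring.
by rewrite E /discriminant -/x; ring.
Qed.

Lemma total_area_trinomial (R : numFieldType) n : (0 < n)%N ->
  (total_area n)%:R =
     2%:R^-1 * (3%:R ^+ n.+1 + 2%:R * (central_trinomial n.+1)%:R
                - (central_trinomial n.+2)%:R
                - 3%:R * (central_trinomial n.+3)%:R
                + (central_trinomial n.+4)%:R) :> R.
Proof.
case: n => // n _.
set x := fpsX R; set c := trinomial_series R; set U := total_area_series R.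
pose e : fps R := Fps (fun n => 3%:R ^+ n).
(* Powers of [x] are written as nested products so that [fpsXMS] peels them off. *)
have E : 2%:R * (x * (x * (x * (x * U)))) =
  3%:R * (x * (x * (x * (x * e)))) + 2%:R * (x * (x * (x * c)))
  - x * (x * c) - 3%:R * (x * c) + c
  + (- 1 + 2%:R * (x * 1) + x * (x * 1) + x * (x * (x * 1))).
  have := total_area_series_trinomial R; rewrite /= -/x -/c -/U -/e => E.
  transitivity (2%:R * x ^+ 4 * U); first by ring.
  by rewrite E; ring.
(* In this degree, at least 5, the cubic polynomial contributes nothing. *)
have := congr1 (fun a => fpscoef a n.+1.+4) E.
rewrite !(fpscoefD, fpscoefN, fpscoef_natM) !fpsXMS /= !mulr0 !addr0.
rewrite oppr0 addr0 -exprS => E5.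
apply: (@mulfI _ 2%:R); first by rewrite pnatr_eq0.
by rewrite E5 mulrA divff ?pnatr_eq0 // mul1r; ring.
Qed.

(** * Central trinomial coefficients are [o(3^n)] *)

Section Asymptotics.
Variable R : realType.

Let b n : R := (central_trinomial n)%:R / 3%:R ^+ n.
(** The recurrence of [b] has limiting characteristic roots 1 and -1/3; this combination removes the
    root -1/3. *)
Let p n : R := b n.+1 + b n / 3%:R.

Lemma scaled_trinomial_ge0 n : 0 <= b n.
Proof. by rewrite /b divr_ge0 ?exprn_ge0. Qed.

Lemma scaled_trinomial_rec n :
  n.+2%:R * b n.+2 = (2 * n + 3)%:R / 3%:R * b n.+1 + n.+1%:R / 3%:R * b n.
Proof.
have /(congr1 (fun m => m%:R : R)) := central_trinomial_rec n.
rewrite natrM natrD 2!natrM => E.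
have h k : 3%:R ^+ k != 0 :> R by rewrite expf_neq0 ?pnatr_eq0.
rewrite /b [LHS]mulrA E 2!exprS; field; exact: h.
Qed.

(** The factor makes the coefficients of [b n.+1] agree; after multiplication by [n + 2] the slack
    is [2/9 b n]. *)
Lemma mixed_trinomial_contraction n : p n.+1 <= (1 - (3%:R * n.+2%:R)^-1) * p n.
Proof.
have n0 : 0 < n.+2%:R :> R by rewrite ltr0n.
rewrite -(ler_pM2l n0) /p mulrDr scaled_trinomial_rec.
have -> : n.+2%:R * ((1 - (3%:R * n.+2%:R)^-1) * (b n.+1 + b n / 3%:R)) =
  (n.+2%:R - 3%:R^-1) * (b n.+1 + b n / 3%:R) by field; rewrite lt0r_neq0.
rewrite -subr_ge0 [X in 0 <= X](_ : _ = 2%:R / 9%:R * b n); last by field.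
by rewrite mulr_ge0 ?scaled_trinomial_ge0.
Qed.

(** With [y = 1 / (3m)] the claim is [(1 - y)^4 <= 1 - 3y]. A cube would fail, since [(1 - y)^3]
    exceeds [1 - 3y] by [y^2 (3 - y)]. *)
Lemma quartic_contraction (m : R) : 2%:R <= m ->
  m * (1 - (3%:R * m)^-1) ^+ 4 <= m - 1.
Proof.
move=> m2; have m0 : 0 < m by lra.
set y := (3%:R * m)^-1; have y0 : 0 <= y by rewrite invr_ge0; lra.
have y6 : y <= 6%:R^-1 by rewrite lef_pV2 ?posrE; lra.
have -> : m - 1 = m * (1 - 3%:R * y) by rewrite /y; field; rewrite lt0r_neq0.
rewrite ler_pM2l // -subr_ge0.
rewrite (_ : _ - _ = y * (1 - 6%:R * y) + y ^+ 3 * (4%:R - y)); last by ring.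
by rewrite addr_ge0 // mulr_ge0 ?exprn_ge0 //; lra.
Qed.

Lemma mixed_trinomial_bound n : n.+1%:R * p n ^+ 4 <= 1.
Proof.
elim: n => [|n IH].
  have -> : p 0 = 2%:R / 3%:R.
    by rewrite /p /b central_trinomial0 central_trinomial1 expr1 expr0; field.
  by lra.
have p0 k : 0 <= p k by rewrite addr_ge0 ?divr_ge0 ?scaled_trinomial_ge0.
have m2 : 2%:R <= n.+2%:R :> R by rewrite ler_nat.
have q0 : 0 <= 1 - (3%:R * n.+2%:R)^-1 :> R.
  by rewrite subr_ge0 invf_le1; lra.
apply: le_trans IH.
apply: le_trans (_ : n.+2%:R * ((1 - (3%:R * n.+2%:R)^-1) * p n) ^+ 4 <= _).
  by rewrite ler_wpM2l // lerXn2r ?nnegrE ?mulr_ge0 // mixed_trinomial_contraction.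
rewrite exprMn mulrA ler_wpM2r ?exprn_ge0 //.
by apply: le_trans (quartic_contraction _ m2) _; rewrite -[n.+2%:R]natr1 addrK.
Qed.

(** For positive index, [b n.+1 <= p n], and the fourth power of [p n] is at most [1 / (n + 1)];
    index 0 is excluded by the lower bound on [n]. *)
Lemma trinomial_le (eps : R) n : 0 < eps -> (eps ^+ 4)^-1 <= n%:R ->
  (central_trinomial n)%:R <= eps * 3%:R ^+ n.
Proof.
move=> e0; have e4 : 0 < eps ^+ 4 by rewrite exprn_gt0.
case: n => [|n] en; first by move: en; rewrite leNgt invr_gt0 e4.
rewrite -ler_pdivrMr ?exprn_gt0 // -/(b n.+1).
have p0 : 0 <= p n by rewrite addr_ge0 ?divr_ge0 ?scaled_trinomial_ge0.
apply: (@le_trans _ _ (p n)); first by rewrite lerDl divr_ge0 ?scaled_trinomial_ge0.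
rewrite -(@ler_pXn2r _ 4) ?nnegrE ?(ltW e0) //.
have n1 : 0 < n.+1%:R :> R by rewrite ltr0n.
rewrite -(ler_pM2l n1); apply: (le_trans (mixed_trinomial_bound n)).
by rewrite -ler_pdivrMr // div1r.
Qed.

End Asymptotics.

Theorem theorem4p3 (R : realType) :
  (let x := fpsX R in
   tofrac (total_area_series R) =
     tofrac ((- 2%:R * x ^+ 3 + x ^+ 2 + 3%:R * x - 1)
               * fps_sqrt (1 - 2%:R * x - 3%:R * x ^+ 2)
             + 2%:R * x ^+ 4 + 7%:R * x ^+ 3 - 4%:R * x + 1)
     / tofrac (6%:R * x ^+ 6 + 4%:R * x ^+ 5 - 2%:R * x ^+ 4)
     :> {fraction fps R})
  /\ (forall n : nat, (1 <= n)%N ->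
       (total_area n)%:R =
         2%:R^-1 * (3%:R ^+ n.+1 + 2%:R * (central_trinomial n.+1)%:R
                    - (central_trinomial n.+2)%:R
                    - 3%:R * (central_trinomial n.+3)%:R
                    + (central_trinomial n.+4)%:R) :> R)
  /\ (fun n : nat => (total_area n)%:R : R)
       ~_ \oo (fun n : nat => 3%:R ^+ n.+1 / 2%:R : R).
Proof.
split; last split.
- move=> x.
  (* The coefficient of [x^4] is -2. *)
  have d0 : 6%:R * x ^+ 6 + 4%:R * x ^+ 5 - 2%:R * x ^+ 4 != 0.
    apply/eqP => /(congr1 (fun a => fpscoef a 4)) /eqP.
    rewrite (_ : 6%:R * x ^+ 6 + 4%:R * x ^+ 5 - 2%:R * x ^+ 4 =
      x * (x * (x * (x * (6%:R * (x * (x * 1)) + 4%:R * (x * 1) - 2%:R * 1))))).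
      rewrite !fpsXMS !(fpscoefD, fpscoefN, fpscoef_natM) !fpsXM0.
      by rewrite !mulr0 !add0r mulr1 oppr_eq0 pnatr_eq0.
    by ring.
  apply: (canRL (mulfK _)); first by rewrite tofrac_eq0.
  by rewrite -tofracM; congr tofrac; exact: total_area_series_eq.
- exact: total_area_trinomial.
apply/eqaddoP => eps e0.
(* The error is at most half of [2*3 + 9 + 3*27 + 81 = 177] times [eps / 100 * 3^n], hence below
   [eps * 3^(n+1) / 2]. *)
have d0 : 0 < eps / 100%:R by rewrite divr_gt0.
near=> n.
have n0 : (0 < n)%N by near: n; exact: nbhs_infty_gt.
have nd : ((eps / 100%:R) ^+ 4)^-1 <= n%:R by near: n; exact: nbhs_infty_ger.
have T k : 0 <= (central_trinomial (n + k))%:R :> R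
    /\ (central_trinomial (n + k))%:R <= eps / 100%:R * 3%:R ^+ (n + k) :> R.
  split=> //; apply: trinomial_le => //; apply: le_trans nd _; rewrite ler_nat; lia.
have h3 : 0 < 3%:R ^+ n :> R by rewrite exprn_gt0.
have [a1 b1] := T 1%N; have [a2 b2] := T 2%N; have [a3 b3] := T 3%N.
have [a4 b4] := T 4%N.
rewrite /= -[(_ - _) n]/(_ - _) total_area_trinomial //.
have g0 : 0 <= 3%:R ^+ n.+1 / 2%:R :> R by rewrite divr_ge0 ?exprn_ge0.
rewrite (ger0_norm g0).
rewrite addn1 addn2 addn3 addn4 !exprS in a1 b1 a2 b2 a3 b3 a4 b4 g0 *.
rewrite ler_norml; apply/andP; split; lra.
Unshelve. all: by end_near.
Qed.
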